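(* Let $q \equiv 5 \pmod{8}$ be a prime power. Then the cyclotomic tournament $CT_q$ is a nearly-doubly-regular tournament if and only if $q = s^2 + 4$ for some odd integer $s$.
   Context: A tournament is an orientation of a complete graph. A tournament with $n$ vertices is regular if $n$ is odd and every vertex has out-degree $(n-1)/2$. For even $n$, a tournament with $n$ vertices is near-regular if every vertex has out-degree $n/2$ or $n/2-1$. A regular tournament with $n$ vertices is nearly-doubly-regular if $n \equiv 1 \pmod 4$ and, for every vertex, both the sub-tournament induced by its out-neighbours and the sub-tournament induced by its in-neighbours are near-regular. Cyclotomic tournament: let $q$ be a prime power with $q \equiv 5 \pmod 8$ (so $q-1 = 4m$ with $m$ odd), let $g$ be a primitive element (generator of $\mathbb{F}_q^*$), let $C_0^{(4)}$ be the subgroup of index $4$ in $\mathbb{F}_q^*$ and $C_i^{(4)} = g^i C_0^{(4)}$. Put $D = C_0^{(4)} \cup C_1^{(4)}$; then $(D,-D)$ partitions $\mathbb{F}_q^*$. The cyclotomic tournament $CT_q$ has vertex set $\mathbb{F}_q$ and an arc from $x$ to $y$ if and only if $x - y \in D$. *)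

(* Defs.v *)
From mathcomp Require Import all_boot all_order all_algebra all_field.
Set Implicit Arguments. Unset Strict Implicit. Unset Printing Implicit Defensive.
Import GRing.Theory.
Local Open Scope ring_scope.

Section Tournaments.
Variable T : finType.
Implicit Types (arc : rel T) (S : {set T}).

Definition is_tournament arc : Prop :=
  (forall x, ~~ arc x x) /\
  (forall x y, x != y -> (arc x y || arc y x) /\ ~~ (arc x y && arc y x)).

Definition outdeg_in arc S (v : T) : nat := #|[set w in S | arc v w]|.

Definition out_nbhd arc (v : T) : {set T} := [set w | arc v w].
Definition in_nbhd arc (v : T) : {set T} := [set w | arc w v].

Definition regular_on arc S : Prop :=
  odd #|S| /\ forall v, v \in S -> outdeg_in arc S v = (#|S|.-1 %/ 2)%N.

Definition near_regular_on arc S : Prop :=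
  ~~ odd #|S| /\ forall v, v \in S ->
    outdeg_in arc S v = (#|S| %/ 2)%N \/ outdeg_in arc S v = (#|S| %/ 2 - 1)%N.

Definition nearly_doubly_regular arc : Prop :=
  is_tournament arc /\ regular_on arc [set: T] /\ (#|T| %% 4 = 1)%N /\
  forall v, near_regular_on arc (out_nbhd arc v) /\
            near_regular_on arc (in_nbhd arc v).
End Tournaments.

Section Cyclotomic.
Variable F : finFieldType.

(* C_0^(4): the subgroup of index 4 of F^*, i.e. the nonzero fourth powers *)
Definition C0_4 : {set F} := [set x ^+ 4 | x in [set y : F | y != 0]].
Definition Ci_4 (g : F) (i : nat) : {set F} := [set g ^+ i * y | y in C0_4].
Definition D_cyc (g : F) : {set F} := Ci_4 g 0 :|: Ci_4 g 1.
Definition CT (g : F) : rel F := fun x y => (x - y) \in D_cyc g.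
End Cyclotomic.

(* Main.v *)
Require Import Defs.
From mathcomp Require Import all_boot all_order all_algebra all_field.
From mathcomp Require Import ring zify.
Set Implicit Arguments. Unset Strict Implicit. Unset Printing Implicit Defensive.
Import Order.TTheory GRing.Theory Num.Theory.
Local Open Scope ring_scope.

(* Write q = 4 m + 1 with m odd and let psi be the sign of x with respect to the
   partition (D, -D).  Since psi (g^2 x) = - psi x, the autocorrelation of psi is
   constant on the two classes of squares and nonsquares, so that
   (psi * psi) d = 1 + delta rho d for d != 0, where rho x = psi x psi (g x) is the
   quadratic character.  Counting shows that CT_q is nearly-doubly-regular iff
   delta = 2 or delta = -2.  With psi' x = psi (g x), one likewise has
   psi * psi' = eps rho, and comparing (psi * psi) * (psi' * psi') with
   (psi * psi') * (psi * psi') at 0 gives q = eps^2 + delta^2, with delta even.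

   Conversely, let q = s^2 + 4 be a power of the prime p.  Expressing psi in F by the
   powers x^m and x^(3m) shows that 4 delta = 2 g^m 'C(3m, m) in F, which is not 0 since
   adding m and 2m in base p produces no carry.  Hence p does not divide delta, and the
   uniqueness of such representations of q as a sum of two squares forces delta^2 = 4. *)

(** * Arithmetic: a binomial coefficient modulo p, prime powers modulo 8, sums of two squares *)

Lemma logn_fact_widen p n N : prime p -> (n < N)%N ->
  logn p n`! = (\sum_(1 <= j < N) n %/ p ^ j)%N.
Proof.
move=> p_pr nN; rewrite logn_fact // [RHS](big_cat_nat (n := n.+1)) //=.
rewrite [X in (_ + X)%N]big_nat_cond [X in (_ + X)%N]big1 ?addn0 // => j /andP[/andP[nj _] _].
rewrite divn_small // (leq_trans (ltn_expl n (prime_gt1 p_pr))) //.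
by rewrite leq_exp2l ?prime_gt1 // ltnW.
Qed.

(** By Legendre's formula over a common range of j, it suffices that the floors of m / p^j and 2m /
    p^j add up to that of 3m / p^j. *)
Lemma bin_quarter_prime p k m : prime p -> (p %% 4 = 1)%N -> (p ^ k = (4 * m).+1)%N ->
  ~~ (p %| 'C(3 * m, m))%N.
Proof.
move=> p_pr p1 pk; have le_m : (m <= 3 * m)%N by lia.
have := congr1 (logn p) (bin_fact le_m).
have -> : (3 * m - m = 2 * m)%N by lia.
have C0 : (0 < 'C(3 * m, m))%N by rewrite bin_gt0.
rewrite !lognM ?muln_gt0 ?fact_gt0 // !(@logn_fact_widen p _ (3 * m).+1) //; try by lia.
rewrite -big_split /= (eq_big_nat _ _ (F2 := fun j => 3 * m %/ p ^ j)%N) => [/eqP|j _].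
  by rewrite -[X in _ == X]add0n eqn_add2r -[p in (p %| _)%N]expn1 pfactor_dvdn // => /eqP->.
have p1j i : (p ^ i %% 4 = 1)%N by rewrite -modnXm p1 exp1n.
have pj0 : (0 < p ^ j)%N by rewrite expn_gt0 prime_gt0.
have [kj|jk] := ltnP k j.
  have : (p ^ k < p ^ j)%N by rewrite ltn_exp2l ?prime_gt1.
  by rewrite pk => ?; rewrite !divn_small //; lia.
have pk' : (p ^ j * p ^ (k - j))%N = (4 * m).+1 by rewrite -expnD subnKC.
move: (p1j j) (p1j (k - j)%N) pk' pj0.
move: (p ^ j)%N (p ^ (k - j))%N => x u x1 u1 xu x0.
(* As x and u are 1 modulo 4 and x u = 4m + 1, dividing m by x leaves x %/ 4, and three times this
   remainder is still below x. *)
have mE : m = ((u %/ 4) * x + x %/ 4)%N by nia.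
have E c : (c < 4)%N -> (c * m %/ x = c * (u %/ 4))%N.
  move=> c4; rewrite mE mulnDr mulnA divnMDl // [X in (_ + X)%N]divn_small ?addn0 //.
  apply: (@leq_ltn_trans (3 * (x %/ 4))%N); rewrite ?leq_mul2r //; lia.
by rewrite -{1}[m]mul1n !E //; lia.
Qed.

(** Odd squares are 1 modulo 8, so the powers of an odd p only take the residues 1 and p. *)
Lemma pow_5mod8_base p k : (p ^ k %% 8 = 5)%N -> (p %% 8 = 5)%N.
Proof.
case: k => [//|k] pk5; have p_odd : odd p.
  by have : odd (p ^ k.+1) by [lia]; rewrite oddX.
suff : (p ^ k.+1 %% 8 \in [:: 1; p %% 8])%N by rewrite !inE pk5 => /eqP.
elim: {pk5} k.+1 => [//|j]; rewrite expnS -modnMm !inE.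
have : odd (p %% 8)%N by lia.
have : (p %% 8 < 8)%N by rewrite ltn_mod.
by case: (p %% 8)%N => [|[|[|[|[|[|[|[|//]]]]]]]] // _ _ /orP[] /eqP->.
Qed.

(* (s t - e) (s t + e) = q (t^2 - 1), and p cannot divide both factors, so that
   q divides one of them; this factor is too small to be a nonzero multiple of q, because
   q^2 = (s e + 4 t)^2 + 4 (s t - e)^2. *)
Lemma sum_squares_unique (p k : nat) (q s e t : int) :
  prime p -> q = p%:Z ^+ k -> q = s ^+ 2 + 4 -> q = e ^+ 2 + (2 * t) ^+ 2 ->
  ~~ (p %| 2 * t)%Z -> t ^+ 2 = 1.
Proof.
move=> p_pr qp qs qt pt.
have k0 : (0 < k)%N by case: k qp => // qp; move: qs; rewrite qp expr0; nia.
have pq : (p %| q)%Z by rewrite qp -(prednK k0) exprS dvdz_mulr.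
have p_euclid x y : (p %| x * y)%Z = (p %| x)%Z || (p %| y)%Z.
  by rewrite !dvdzE abszM Euclid_dvdM.
have pe : ~~ (p %| e)%Z.
  apply: contra pt => pe; have : (p %| q - e * e)%Z by rewrite rpredB // dvdz_mulr.
  rewrite qt (_ : _ - _ = (2 * t) * (2 * t)); last by ring.
  by rewrite (p_euclid (2 * t) (2 * t)) orbb.
have q_gt0 : 0 < q by rewrite qs; nia.
have dvd_t1 e' : q = e' ^+ 2 + (2 * t) ^+ 2 -> (q %| s * t - e')%Z -> t ^+ 2 = 1.
  move=> qe' /dvdzP[z zE].
  have q2 : q ^+ 2 = (s * e' + 4 * t) ^+ 2 + 4 * (z * q) ^+ 2.
    by rewrite -zE expr2 {1}qs qe'; ring.
  have z0 : z = 0.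
    have : 4 * z ^+ 2 * q ^+ 2 <= 1 * q ^+ 2.
      by rewrite mul1r {2}q2 -lerBlDr; have := sqr_ge0 (s * e' + 4 * t); lia.
    rewrite ler_pM2r ?exprn_gt0 // => z4; apply/eqP; rewrite -sqrf_eq0 eq_le sqr_ge0 andbT.
    by move: (z ^+ 2) z4; clear=> y; lia.
  have stE : s * t = e' by apply: subr0_eq; rewrite zE z0 mul0r.
  apply: (@mulIf _ q); first by rewrite gt_eqF.
  by rewrite mul1r [RHS]qe' -stE qs; ring.
have : (q %| (s * t - e) * (s * t + e))%Z.
  apply/dvdzP; exists (t ^+ 2 - 1).
  have -> : (s * t - e) * (s * t + e) = s ^+ 2 * t ^+ 2 - e ^+ 2 by ring.
  have -> : s ^+ 2 = q - 4 by rewrite qs; ring.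
  have -> : e ^+ 2 = q - (2 * t) ^+ 2 by rewrite qt; ring.
  ring.
have q_co x : ~~ (p %| x)%Z -> coprimez q x.
  by move=> px; rewrite qp coprimezE abszX coprimeXl // prime_coprime // -dvdzE.
have [pm|pm] := boolP (p %| s * t - e)%Z; last first.
  by rewrite Gauss_dvdzr ?q_co // -[e in _ + e]opprK; apply: dvd_t1; rewrite sqrrN.
rewrite Gauss_dvdzl; first exact: dvd_t1.
apply: q_co; apply: contra pt => pp.
have : (p %| (s * t + e) - (s * t - e))%Z by rewrite rpredB.
rewrite (_ : _ - _ = 2 * e); last by ring.
by rewrite !p_euclid (negPf pe) orbF => ->.
Qed.

(** * Membership in D through discrete logarithms *)

Section QuarticSign.
Variables (F : finFieldType) (g : F).
Hypotheses (q5 : (#|F| %% 8 = 5)%N) (prim_g : (#|F|.-1).-primitive_root g).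

Let m := (#|F| %/ 4)%N.

Lemma card_eq : #|F| = (4 * m).+1.
Proof. by rewrite /m; lia. Qed.

Lemma odd_m : odd m.
Proof. by rewrite /m; lia. Qed.

Let prim4 : (4 * m).-primitive_root g.
Proof. by move: prim_g; rewrite card_eq. Qed.

Lemma g_neq0 : g != 0.
Proof.
apply/eqP => g0; have := prim_expr_order prim4.
by rewrite g0 expr0n muln_eq0 /= eqn0Ngt (odd_gt0 odd_m) => /esym/eqP; rewrite oner_eq0.
Qed.

Lemma expg_surj (x : F) : x != 0 -> exists k, x = g ^+ k.
Proof.
move=> x0; have [|i ->] := prim_rootP prim4 (x := x); last by exists i.
by apply: (mulfI x0); rewrite -exprS -card_eq expf_card mulr1.
Qed.

Lemma mem_C0 k : (g ^+ k \in C0_4 F) = (4 %| k)%N.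
Proof.
apply/imsetP/idP => [[y]|/dvdnP[j ->]].
  rewrite inE => /expg_surj[j ->] /eqP.
  rewrite -exprM (eq_prim_root_expr prim4) => /eqP/(congr1 (modn^~ 4)).
  by rewrite !modn_dvdm ?dvdn_mulr // modnMl /dvdn => ->.
by exists (g ^+ j); rewrite ?inE ?expf_neq0 ?g_neq0 // exprM.
Qed.

Definition inD (x : F) : bool := x \in D_cyc g.

Lemma inD_expg k : inD (g ^+ k) = (k %% 4 < 2)%N.
Proof.
have C i j : (g ^+ (i + j) \in Ci_4 g i) = (4 %| j)%N.
  rewrite exprD mem_imset ?mem_C0 //.
  by apply: mulfI; rewrite expf_neq0 ?g_neq0.
(* Adding 4m - 1 to the exponent stands for subtracting 1, which would truncate at k = 0. *)
transitivity ((4 %| k) || (4 %| k + (4 * m).-1))%N; last by have := odd_m; lia.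
rewrite /inD in_setU; congr orb; first exact: (C 0%N k).
have <- : g ^+ (1 + (k + (4 * m).-1)) = g ^+ k.
  rewrite -[RHS]mulr1 -(prim_expr_order prim4) -exprD; congr (_ ^+ _).
  by have := odd_m; lia.
exact: C.
Qed.

Lemma inD0 : inD 0 = false.
Proof.
apply/negP; rewrite /inD in_setU => /orP[] /imsetP[y /imsetP[z]];
  rewrite inE => z0 -> /esym/eqP;
  by rewrite mulf_eq0 !expf_eq0 (negPf g_neq0) (negPf z0) /= ?andbF.
Qed.

Lemma oppr1_expg : -1 = g ^+ (2 * m).
Proof.
have /eqP : (g ^+ (2 * m)) ^+ 2 = 1.
  by rewrite -exprM -(prim_expr_order prim4); congr (_ ^+ _); lia.
rewrite sqrf_eq1 => /orP[|/eqP -> //].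
rewrite -[1](expr0 g) (eq_prim_root_expr prim4) mod0n => /eqP.
by rewrite modn_small; have := odd_m; lia.
Qed.

(** Since m is odd, multiplying by -1 = g^(2m) shifts the exponent by 2 modulo 4. *)
Lemma inDN x : x != 0 -> inD (- x) = ~~ inD x.
Proof.
move=> /expg_surj[k ->]; rewrite -mulN1r oppr1_expg -exprD !inD_expg.
by have := odd_m; lia.
Qed.

(** * The sign [psi] and the quadratic character [rho] *)

Definition psi (x : F) : int := (inD x)%:R - (inD (- x))%:R.

Lemma psi_expg k : psi (g ^+ k) = (-1) ^+ (k %/ 2).
Proof.
rewrite /psi inDN ?expf_neq0 ?g_neq0 // inD_expg -signr_odd.
have -> : odd (k %/ 2) = ~~ (k %% 4 < 2)%N by lia.
by case: ltnP.
Qed.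

Lemma psi0 : psi 0 = 0.
Proof. by rewrite /psi oppr0 subrr. Qed.

Lemma psiN x : psi (- x) = - psi x.
Proof. by rewrite /psi opprK opprB. Qed.

Lemma psi_sqr x : psi x ^+ 2 = (x != 0)%:R.
Proof.
have [->|/expg_surj[k ->]] := eqVneq x 0; first by rewrite psi0 expr0n.
by rewrite psi_expg sqrr_sign.
Qed.

Lemma psi_gg x : psi (g * (g * x)) = - psi x.
Proof.
have [->|/expg_surj[k ->]] := eqVneq x 0; first by rewrite !mulr0 psi0 oppr0.
by rewrite -!exprS !psi_expg -addn2 divnDr // divnn addn1 exprS mulN1r.
Qed.

Definition rho x := psi x * psi (g * x).

Lemma rho_g x : rho (g * x) = - rho x.
Proof. by rewrite /rho psi_gg mulrN mulrC. Qed.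

Lemma rho1 : rho 1 = 1.
Proof. by rewrite /rho mulr1 -[X in psi X * _](expr0 g) -[X in _ * psi X]expr1 !psi_expg. Qed.

Lemma rhoN x : rho (- x) = rho x.
Proof. by rewrite /rho mulrN !psiN mulrNN. Qed.

Lemma rho_sqr x : rho x ^+ 2 = (x != 0)%:R.
Proof. by rewrite exprMn !psi_sqr mulf_eq0 (negPf g_neq0) /= -natrM mulnb andbb. Qed.

Lemma sum_g (R : nmodType) (f : F -> R) : \sum_x f (g * x) = \sum_x f x.
Proof. by rewrite [RHS](reindex_inj (mulfI g_neq0)). Qed.

Lemma anti_g_rho (Q : F -> int) d :
  (forall x, Q (g * x) = - Q x) -> d != 0 -> Q d = Q 1 * rho d.
Proof.
move=> Qg /expg_surj[k ->]; elim: k => [|k IH]; first by rewrite expr0 rho1 mulr1.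
by rewrite exprS Qg IH rho_g mulrN.
Qed.

(** * Correlations of [psi] and the identity q = eps^2 + delta^2 *)

Definition conv (a b : F -> int) d : int := \sum_x a x * b (d - x).

(* Both sides sum a u * b v * c w * d z over all u + v + w + z = 0. *)
Lemma conv_exchange (a b c d : F -> int) :
  \sum_x conv a b x * conv c d (- x) = \sum_x conv a c x * conv b d (- x).
Proof.
have E (a' b' c' d' : F -> int) : \sum_x conv a' b' x * conv c' d' (- x) =
    \sum_u \sum_v \sum_w a' u * b' v * (c' w * d' (- (u + v + w))).
  under eq_bigr => x _ do rewrite mulr_suml.
  rewrite exchange_big; apply: eq_bigr => u _.
  rewrite (reindex_inj (addrI u)); apply: eq_bigr => v _.
  rewrite addrAC subrr add0r mulr_sumr; apply: eq_bigr => w _.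
  by congr (_ * (_ * d' _)); ring.
rewrite !E; apply: eq_bigr => u _; rewrite exchange_big.
apply: eq_bigr => v _; apply: eq_bigr => w _.
by rewrite (addrAC u v w); ring.
Qed.

Lemma sum_psi : \sum_x psi x = 0.
Proof.
have : \sum_x psi (- x) = \sum_x psi x.
  by rewrite [RHS](reindex_inj oppr_inj).
by under eq_bigr do rewrite psiN; rewrite sumrN; set t := (\sum_x _); lia.
Qed.

Lemma sum_neq0 : \sum_(x : F) (x != 0)%:R = (4 * m)%:R :> int.
Proof. by rewrite -natr_sum -big_mkcond sum1_card (cardC1 0) card_eq. Qed.

Definition delta : int := conv psi psi 1 - 1.

Lemma psi_conv0 : conv psi psi 0 = - (4 * m)%:R.
Proof.
rewrite /conv -sum_neq0 -sumrN; apply: eq_bigr => x _.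
by rewrite sub0r psiN mulrN -psi_sqr.
Qed.

Lemma psi_conv_gg d : conv psi psi (g * (g * d)) = conv psi psi d.
Proof.
rewrite /conv -sum_g -sum_g; apply: eq_bigr => x _.
by rewrite -!mulrBr !psi_gg mulrNN.
Qed.

Lemma sum_psi_conv : \sum_d conv psi psi d = 0.
Proof.
rewrite /conv exchange_big /= big1 // => x _; rewrite -mulr_sumr.
by rewrite (reindex_inj (addIr x)); under eq_bigr do rewrite addrK; rewrite sum_psi mulr0.
Qed.

Lemma psi_convE d : d != 0 -> conv psi psi d = 1 + delta * rho d.
Proof.
pose f := conv psi psi; pose c := f 1 + f g.
have fc x : x != 0 -> f x + f (g * x) = c.
  move=> /expg_surj[k ->]; elim: k => [|k IH]; first by rewrite expr0 mulr1.
  by rewrite exprS addrC {1}/f psi_conv_gg.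
(* The sum of f x + f (g x) over all x vanishes; x = 0 contributes -8m and each of the 4m other
   terms is c. *)
have c2 : c = 2.
  have : \sum_(x | x != 0) (f x + f (g * x)) = c * (4 * m)%:R.
    rewrite (eq_bigr (fun=> c)) // sumr_const (cardC1 0) card_eq.
    by rewrite mulr_natr.
  have : \sum_x (f x + f (g * x)) = 0.
    by rewrite big_split /= sum_g sum_psi_conv addr0.
  rewrite (bigD1 0) //= mulr0 => + E; rewrite {}E /f psi_conv0.
  by have := odd_m; nia.
(* Setting Q 0 = 0 makes Q (g x) = - Q x hold at 0 too, as [anti_g_rho] requires. *)
move=> d0; pose Q x := if x == 0 then 0 else f x - 1.
have : Q d = Q 1 * rho d.
  apply: anti_g_rho d0 => x; rewrite /Q mulf_eq0 (negPf g_neq0) /=.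
  by case: eqVneq => [|/fc]; rewrite ?oppr0 // c2; lia.
by rewrite /Q (negPf d0) oner_eq0 /delta -/f => <-; rewrite addrC subrK.
Qed.

Lemma cross_convE : {eps : int | forall d, conv psi (psi \o *%R g) d = eps * rho d}.
Proof.
exists (conv psi (psi \o *%R g) 1) => d.
have [->|] := eqVneq d 0; last first.
  apply: anti_g_rho => x; rewrite /conv -sum_g /=.
  under eq_bigr do rewrite -mulrBr psi_gg mulrN.
  rewrite sumrN; congr (- _).
  (* Scaling by g has moved the twist from one factor to the other with a sign; the reflection y ->
     x - y swaps them back. *)
  rewrite [RHS](reindex_inj (inv_inj (subKr x))); apply: eq_bigr => y _.
  by rewrite subKr mulrC.
rewrite [rho 0]/rho psi0 mul0r mulr0.
transitivity (- \sum_x rho x).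
  by rewrite -sumrN; apply: eq_bigr => x _; rewrite /= sub0r mulrN psiN mulrN.
have := sum_g rho; under eq_bigr do rewrite rho_g.
by rewrite sumrN; set t := (\sum_x _); lia.
Qed.

Lemma delta_sum_squares : {eps : int | eps ^+ 2 + delta ^+ 2 = #|F|%:R}.
Proof.
have [eps cE] := cross_convE; exists eps.
have := conv_exchange psi psi (psi \o *%R g) (psi \o *%R g).
have gE d : conv (psi \o *%R g) (psi \o *%R g) d = conv psi psi (g * d).
  by rewrite /conv -[RHS]sum_g; apply: eq_bigr => x _; congr (_ * psi _); exact: mulrBr.
have -> : \sum_x conv psi (psi \o *%R g) x * conv psi (psi \o *%R g) (- x) =
    eps ^+ 2 * (4 * m)%:R.
  rewrite -sum_neq0 mulr_sumr; apply: eq_bigr => x _.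
  by rewrite !cE rhoN -rho_sqr; ring.
(* The term at 0 is (4m)^2 and each other one is (1 - delta rho x)(1 + delta rho x) = 1 - delta^2;
   dividing the total by 4m gives the claim. *)
rewrite (bigD1 0) //= gE oppr0 mulr0 psi_conv0.
rewrite (eq_bigr (fun=> 1 - delta ^+ 2)) => [|x x0].
  rewrite sumr_const (cardC1 0) card_eq /= -mulr_natr.
  by have := odd_m; nia.
rewrite gE !psi_convE ?mulf_neq0 ?oppr_eq0 ?g_neq0 // rho_g rhoN.
rewrite -[delta ^+ 2]mulr1 -[X in _ - _ * X]/(true%:R) -x0 -rho_sqr.
ring.
Qed.

(** * Degrees in neighbourhoods as counts of differences in D *)

Lemma inDD x : (inD x)%:R + (inD (- x))%:R = (x != 0%R)%:R :> int.
Proof.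
have [->|x0] := eqVneq x 0; first by rewrite oppr0 inD0.
by rewrite inDN //; case: inD.
Qed.

Lemma card_setE (P : pred F) : #|[set x | P x]|%:R = \sum_x (P x)%:R :> int.
Proof. by rewrite -natr_sum -big_mkcond sum1dep_card. Qed.

Lemma card_D : #|[set x | inD x]| = (2 * m)%N.
Proof.
have := sum_neq0; under eq_bigr do rewrite -inDD.
rewrite big_split /= [X in _ + X](reindex_inj oppr_inj) /=.
under [X in _ + X]eq_bigr do rewrite opprK.
by rewrite -card_setE; set c := #|_|; rewrite -natrD => /eqP; rewrite eqr_nat; lia.
Qed.

Lemma psi_conv_card d : d != 0 ->
  conv psi psi d = (4 * m)%:R - 1 - #|[set e | inD e && inD (e - d)]|%:R *+ 4.
Proof.
move=> d0; have nz : \sum_e ((e != 0)%:R * (d - e != 0)%:R) = (4 * m)%:R - 1 :> int.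
  rewrite -sum_neq0 [RHS]addrC (bigD1 d) //= [\sum_(x : F) _](bigD1 d) //= d0.
  rewrite subrr eqxx mulr0 add0r addKr; apply: eq_bigr => e ed.
  by rewrite subr_eq0 [d == e]eq_sym ed mulr1.
have N' : \sum_e ((inD (- e))%:R * (inD (d - e))%:R) =
    #|[set e | inD e && inD (e - d)]|%:R :> int.
  rewrite card_setE (reindex_inj (inv_inj (subKr d))); apply: eq_bigr => e _.
  by rewrite subKr opprB -natrM mulnb andbC.
(* For indicators, (a - a')(b - b') = (a + a')(b + b') - 2 a b' - 2 a' b; both mixed terms sum to
   the same count, by e -> d - e. *)
transitivity (\sum_e ((e != 0)%:R * (d - e != 0)%:R
    - (inD e && inD (e - d))%:R * 2 - (inD (- e))%:R * (inD (d - e))%:R * 2 : int)).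
  apply: eq_bigr => e _.
  by rewrite -!inDD /psi opprB -mulnb natrM; ring.
by rewrite !sumrB -!mulr_suml -card_setE N' nz; ring.
Qed.

Lemma outdeg_out v w : outdeg_in (CT g) (out_nbhd (CT g) v) w =
  #|[set e | inD e && inD (e - (v - w))]|.
Proof.
rewrite /outdeg_in -(card_imset _ (inv_inj (subKr v))); apply: eq_card => e.
rewrite (can2_imset_pre _ (subKr v) (subKr v)) !inE /CT -!/(inD _).
by rewrite subKr; congr (_ && inD _); ring.
Qed.

Lemma outdeg_in_nbhd v w : outdeg_in (CT g) (in_nbhd (CT g) v) w =
  #|[set e | inD e && inD ((w - v) - e)]|.
Proof.
rewrite /outdeg_in -(card_imset _ (addrI (- v))); apply: eq_card => e.
rewrite (can2_imset_pre _ (addKr (- v)) (addNKr (- v))) !inE /CT -!/(inD _) opprK.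
by congr (inD _ && inD _); ring.
Qed.

Lemma card_out_nbhd v : #|out_nbhd (CT g) v| = (2 * m)%N.
Proof.
rewrite -card_D -(card_imset _ (inv_inj (subKr v))); apply: eq_card => e.
by rewrite (can2_imset_pre _ (subKr v) (subKr v)) !inE /CT -!/(inD _) subKr.
Qed.

Lemma card_in_nbhd v : #|in_nbhd (CT g) v| = (2 * m)%N.
Proof.
rewrite -card_D -(card_imset _ (addrI (- v))); apply: eq_card => e.
rewrite (can2_imset_pre _ (addKr (- v)) (addNKr (- v))) !inE /CT -!/(inD _) opprK.
by congr (inD _); ring.
Qed.

(** Each e in D other than d has exactly one of e - d, d - e in D; the 1 counts e = d.
    In-neighbourhood degrees thus follow from out-neighbourhood ones, and m and m - 1 are
    exchanged. *)
Lemma card_split d : inD d ->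
  (#|[set e | inD e && inD (e - d)%R]| + #|[set e | inD e && inD (d - e)%R]| + 1
   = 2 * m)%N.
Proof.
move=> dD; apply/eqP; rewrite -card_D -(eqr_nat int) !natrD !card_setE.
have -> : 1%:R = \sum_(e : F) (e == d :> F)%:R :> int.
  by rewrite (bigD1 d) //= eqxx big1 ?addr0 // => e /negPf->.
rewrite -!big_split /=; apply/eqP/eq_bigr => e _.
have [->|ed] := eqVneq e d; first by rewrite subrr dD inD0.
by rewrite -opprB inDN ?subr_eq0 1?eq_sym //; do 2!case: inD.
Qed.

Lemma CT_tournament : is_tournament (CT g).
Proof.
split=> [x|x y xy]; first by rewrite /CT subrr -/(inD 0) inD0.
rewrite /CT -!/(inD _) -(opprB x y) inDN ?subr_eq0 //.
by case: inD.
Qed.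

Lemma nearly_doubly_regularE : nearly_doubly_regular (CT g) <-> delta ^+ 2 = 4.
Proof.
have N4 d : d != 0 -> #|[set e | inD e && inD (e - d)]|%:R *+ 4 =
    (4 * m)%:R - 2 - delta * rho d :> int.
  move=> d0; have := psi_conv_card d0; rewrite psi_convE //; lia.
have inD1 : inD 1 by rewrite -(expr0 g) inD_expg.
split.
  (* One degree suffices: the out-neighbour -1 of 0 has difference 1, where [rho] is 1. *)
  case=> _ [_ [_ /(_ 0)[[_ /(_ (-1))] +] _]].
  rewrite outdeg_out card_out_nbhd inE /CT sub0r opprK -/(inD 1) inD1 => /(_ isT).
  have := N4 1 (oner_neq0 _); rewrite rho1 mulr1; set c := #|_|.
  have := odd_m; nia.
move=> d4; split; first exact: CT_tournament.
have Nd d : inD d -> #|[set e | inD e && inD (e - d)]| = m \/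
    #|[set e | inD e && inD (e - d)]| = (m - 1)%N.
  move=> dD; have d0 : d != 0 by apply: contraTneq dD => ->; rewrite inD0.
  have := rho_sqr d; have := N4 d d0; rewrite d0; set c := #|_|.
  have := odd_m; nia.
split.
  split=> [|v _]; first by rewrite cardsT card_eq; lia.
  rewrite cardsT card_eq -[RHS]/(4 * m %/ 2)%N -[RHS](_ : (2 * m = _)%N); last by lia.
  by rewrite -(card_out_nbhd v); apply: eq_card => w; rewrite !inE.
split; first by rewrite card_eq; lia.
have m2 : (2 * m %/ 2 = m)%N by rewrite mulKn.
move=> v; split; split=> [|w]; rewrite ?card_out_nbhd ?card_in_nbhd ?oddM // m2.
  by rewrite inE outdeg_out; apply: Nd.
rewrite inE outdeg_in_nbhd => wD.
have := Nd _ wD; have := card_split wD; rewrite /CT; set c := #|_|; set c' := #|_|.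
have := odd_m; lia.
Qed.

(** * Parity of [delta] and its value in F through power sums *)

Lemma delta_even : exists t : int, delta = 2 * t.
Proof.
have := psi_conv_card (oner_neq0 F); rewrite psi_convE ?oner_neq0 // rho1 mulr1.
set c := #|_| => E; exists (2 * m%:R - 1 - 2 * c%:R : int).
by lia.
Qed.

Lemma card_char0 : #|F|%:R = 0 :> F.
Proof.
have : \sum_(x : F) (x + 1) = \sum_(x : F) x.
  by rewrite [RHS](reindex_inj (addIr 1)).
rewrite big_split /= sumr_const => /eqP.
by rewrite -subr_eq0 addrAC subrr add0r => /eqP.
Qed.

(** Replacing y by g y scales the sum by g^k, which is 1 in this range only for k = 0 and k = 4m. At
    k = 0 the convention 0^0 = 1 yields q = 0 in F. *)
Lemma sum_expf k : (k < 8 * m)%N -> \sum_(y : F) y ^+ k = - (k == 4 * m)%:R :> F.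
Proof.
move=> k8; have m0 := odd_gt0 odd_m.
have [->|k0] := posnP k.
  rewrite (_ : _ == _ = false); last by lia.
  rewrite oppr0 -[RHS]card_char0 -sumr_const.
  by apply: eq_bigr => y _; rewrite expr0.
have [->|k4] := eqVneq k.
  rewrite (bigD1 0) //= expr0n muln_eq0 /= eqn0Ngt m0 add0r.
  rewrite (eq_bigr (fun=> 1)) => [|y /expg_surj[j ->]].
    apply: (addIr 1); rewrite addNr sumr_const (cardC1 0) -mulrSr prednK ?card_char0 //.
    by rewrite card_eq.
  by rewrite exprAC (prim_expr_order prim4) expr1n.
rewrite oppr0; apply/eqP; have gk : g ^+ k != 1.
  rewrite -[1](expr0 g) (eq_prim_root_expr prim4) mod0n.
  by apply/negP => /dvdnP[[|[|j]] jE]; move: k8 k4 k0; rewrite jE; lia.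
have : \sum_(y : F) (g * y) ^+ k = \sum_(y : F) y ^+ k by rewrite (sum_g (fun y => y ^+ k)).
under eq_bigr do rewrite exprMn.
move/eqP; rewrite -mulr_sumr -subr_eq0 -[X in _ - X]mul1r -mulrBl mulf_eq0 subr_eq0.
by rewrite (negPf gk).
Qed.

(** This is a Jacobi sum reduced into F: in the binomial expansion only the total exponent 4m
    survives. *)
Lemma sum_beta a b : (a <= 4 * m)%N -> (a + b < 8 * m)%N ->
  \sum_(y : F) y ^+ a * (1 - y) ^+ b =
    - ((-1) ^+ (4 * m - a) * 'C(b, 4 * m - a)%:R).
Proof.
move=> a4 ab; under eq_bigr do rewrite exprBn mulr_sumr.
rewrite exchange_big /=.
rewrite (eq_bigr (fun j : 'I_b.+1 => if (j : nat) == (4 * m - a)%N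
    then - ((-1) ^+ (4 * m - a) * 'C(b, 4 * m - a)%:R) else 0)) => [|j _].
  rewrite -big_mkcond; case: (ltnP (4 * m - a) b.+1) => hb.
    by rewrite (big_pred1 (Ordinal hb)).
  by rewrite bin_small // mulr0 oppr0 big1.
rewrite (eq_bigr (fun y => (-1) ^+ j * 'C(b, j)%:R * y ^+ (a + j))) => [|y _].
  rewrite -mulr_sumr sum_expf; last by have := ltn_ord j; lia.
  have -> : (a + j == 4 * m)%N = ((j : nat) == (4 * m - a)%N) by lia.
  by case: eqP => [->|_]; rewrite ?mulrN1 // oppr0 mulr0.
by rewrite expr1n mulr1 -mulrnAl -mulr_natr exprD; ring.
Qed.

Let i := g ^+ m.

Lemma sqr_i : i ^+ 2 = -1.
Proof. by rewrite oppr1_expg -exprM mulnC. Qed.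

(* psi is the real part of (1 - i) chi, where chi is the quartic character with chi g = i;
   in F the character chi becomes the power map x^m, and its conjugate x^(3m). *)
Lemma psi_poly y : 2 * (psi y)%:~R = (1 - i) * y ^+ m + (1 + i) * y ^+ (3 * m).
Proof.
have m0 := odd_gt0 odd_m.
have [->|/expg_surj[k ->]] := eqVneq y 0.
  by rewrite psi0 !expr0n muln_eq0 /= eqn0Ngt m0 !mulr0 addr0.
rewrite psi_expg rmorphXn rmorphN1 exprAC -/i mulnC exprM [_ ^+ k ^+ m]exprAC -/i.
have i4 : i ^+ 4 = 1 by rewrite (exprM i 2 2) sqr_i expr2 mulrNN mulr1.
rewrite {2 3}(divn_eq k 4) exprD mulnC exprM i4 expr1n mul1r -signr_odd.
have -> : odd (k %/ 2) = (1 < k %% 4)%N by lia.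
have := ltn_pmod k (isT : 0 < 4)%N; have i2 := sqr_i; move: i i2 => j i2.
by case: (k %% 4)%N => [|[|[|[|//]]]] _ /=; ring: i2.
Qed.

Lemma delta_mod : 4 * delta%:~R = 2 * i * 'C(3 * m, m)%:R.
Proof.
have m0 := odd_gt0 odd_m.
have : 4 * (conv psi psi 1)%:~R = 4 + 2 * i * 'C(3 * m, m)%:R :> F.
  transitivity (\sum_y ((1 - i) ^+ 2 * (y ^+ m * (1 - y) ^+ m)
      + (1 - i ^+ 2) * (y ^+ m * (1 - y) ^+ (3 * m))
      + (1 - i ^+ 2) * (y ^+ (3 * m) * (1 - y) ^+ m)
      + (1 + i) ^+ 2 * (y ^+ (3 * m) * (1 - y) ^+ (3 * m)))).
    rewrite rmorph_sum mulr_sumr; apply: eq_bigr => y _; rewrite rmorphM /=.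
    transitivity ((2 * (psi y)%:~R) * (2 * (psi (1 - y))%:~R) : F); first by ring.
    by rewrite !psi_poly; ring.
  (* The four sums are 0 (as m < 3m), 1, 1 and 'C(3m, m), the signs cancelling since m is odd. *)
  rewrite !big_split -!mulr_sumr /= !sum_beta; try lia.
  have -> : (4 * m - m = 3 * m)%N by lia.
  have -> : (4 * m - 3 * m = m)%N by lia.
  rewrite !binn bin_small; last by lia.
  have -> : (-1) ^+ m = -1 :> F by rewrite -signr_odd odd_m.
  have -> : (-1) ^+ (3 * m) = -1 :> F by rewrite -signr_odd oddM odd_m.
  have := sqr_i; move: i ('C(3 * m, m)%:R : F) => j c i2; rewrite i2; ring: i2.
by rewrite /delta rmorphB /= mulrBr => ->; ring.
Qed.

Lemma delta_not_dvd p : p \in [pchar F] -> ~~ (p %| delta)%Z.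
Proof.
move=> pF; have p_pr := pcharf_prime pF.
pose k := logn p #|F|; have cF : #|F| = (p ^ k)%N := card_pprimeChar pF.
have p5 : (p %% 8 = 5)%N by apply: (@pow_5mod8_base p k); rewrite -cF.
rewrite (dvdz_pcharf pF); apply/eqP => d0; have := delta_mod; rewrite d0 mulr0 => /esym/eqP.
rewrite !mulf_eq0 expf_eq0 (negPf g_neq0) andbF orbF -!(dvdn_pcharf pF).
rewrite (negPf (@bin_quarter_prime p k m _ _ _)) ?orbF -?cF ?card_eq //; last by lia.
(* What remains is p dividing 2, excluded by p = 5 modulo 8. *)
by move/dvdn_leq => /(_ isT); lia.
Qed.

End QuarticSign.

Theorem theorem1 (F : finFieldType) (g : F)
  (hq : (#|F| %% 8 = 5)%N)
  (hg : ((#|F|.-1).-primitive_root g)%R) :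
  nearly_doubly_regular (CT g) <->
  exists s : nat, odd s /\ #|F| = (s ^ 2 + 4)%N.
Proof.
have [eps epsE] := delta_sum_squares hq hg.
rewrite (nearly_doubly_regularE hq hg); split=> [d4|[s [_ sE]]].
  have cE : #|F| = (absz eps ^ 2 + 4)%N.
    apply/eqP; rewrite -(eqr_nat int) -epsE d4 natrD natrX [(absz eps)%:R]natz abszE.
    by rewrite real_normK // num_real.
  exists (absz eps); split=> //.
  by have : odd #|F| by [lia]; rewrite cE oddD oddX addbF.
have [t tE] := delta_even hq hg; have [p p_pr pF] := finPcharP F.
have cF : #|F| = (p ^ logn p #|F|)%N := card_pprimeChar pF.
have := delta_not_dvd hq hg pF; rewrite tE => pt.
suff : t ^+ 2 = 1 by move=> t1; rewrite exprMn t1.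
apply: (@sum_squares_unique p (logn p #|F|) #|F|%:R s%:R eps t) => //.
- by rewrite -[Posz p]natz -natrX -cF.
- by rewrite sE natrD natrX.
- by rewrite -epsE tE.
Qed.
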